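(* Let $n\geq 3$ and $k\geq 1$ be integers, let $K$ be a field, and let $R=K[V(T_{n,k})]$. Then the projective dimension of the $R$-module $R/I(T_{n,k})$ is $$\operatorname{pdim}(R/I(T_{n,k}))=\begin{cases}\dfrac{n(n-1)^{k}-2}{n-2}-\dfrac{n(n-1)^{k+1}+n^{3}-4n^{2}+4n-2}{(n-1)^{3}-1}, & \text{if } k\equiv 0 \pmod 3;\\[2mm] \dfrac{n(n-1)^{k}-2}{n-2}-\dfrac{n(n-1)^{k+1}-n^{2}+2n-2}{(n-1)^{3}-1}, & \text{if } k\equiv 1 \pmod 3;\\[2mm] \dfrac{n(n-1)^{k}-2}{n-2}-\dfrac{n(n-1)^{k+1}-n}{(n-1)^{3}-1}, & \text{if } k\equiv 2 \pmod 3.\end{cases}$$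
   Context: For a finite simple graph $G$, $K[V(G)]$ denotes the polynomial ring over $K$ whose variables are the vertices of $G$, and the edge ideal $I(G)\subset K[V(G)]$ is the ideal generated by the monomials $xy$ with $\{x,y\}$ an edge of $G$. Perfect semiregular tree $T_{n,k}$: the rooted tree in which all non-pendant vertices (vertices of degree $\neq 1$) have degree $n$ and all pendant vertices (leaves) are at distance $k$ from the root. Explicitly, the root has $n$ children, every other non-leaf vertex has exactly $n-1$ children, and all leaves are at distance $k$ from the root. Projective dimension: for a finitely generated graded module $M$ over a polynomial ring with graded Betti numbers $\beta_{i,j}(M)$, $\operatorname{pdim}(M)=\max\{i:\beta_{i,j}(M)\neq 0 \text{ for some } j\}$. *)

(* Defs.v *)
From HB Require Import structures.
From mathcomp Require Import all_boot all_order all_algebra.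
From mathcomp Require Import ring_quotient boolp mpoly.

Set Implicit Arguments.
Unset Strict Implicit.
Unset Printing Implicit Defensive.

Import GRing.Theory.

Local Open Scope ring_scope.
Local Open Scope quotient_scope.

Definition ideal_gen (R : comNzRingType) (S : R -> Prop) : {pred R} :=
  [pred f | `[< exists s : seq (R * R),
      (forall cg, cg \in s -> S cg.2) /\ f = \sum_(cg <- s) cg.1 * cg.2 >]].

Section IdealQuotient.

Variables (R : comNzRingType) (S : R -> Prop).

Lemma ideal_genP f :
  reflect (exists s : seq (R * R),
      (forall cg, cg \in s -> S cg.2) /\ f = \sum_(cg <- s) cg.1 * cg.2)
    (f \in ideal_gen S).
Proof. exact: asboolP. Qed.

Lemma ideal_genD : {in ideal_gen S &, forall f g, f + g \in ideal_gen S}.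
Proof.
move=> f g /ideal_genP[s [Ss ->]] /ideal_genP[t [St ->]].
apply/ideal_genP; exists (s ++ t); split; last by rewrite big_cat.
by move=> cg; rewrite mem_cat => /orP[/Ss|/St].
Qed.

Lemma ideal_genMl a f : f \in ideal_gen S -> a * f \in ideal_gen S.
Proof.
move=> /ideal_genP[s [Ss ->]].
apply/ideal_genP; exists [seq (a * cg.1, cg.2) | cg <- s]; split.
  by move=> _ /mapP[cg /Ss Scg ->].
by rewrite big_map mulr_sumr; apply: eq_bigr => cg _; rewrite mulrA.
Qed.

Lemma ideal_gen_zmod : zmod_closed (ideal_gen S).
Proof.
split=> [|f g If Ig].
  by apply/ideal_genP; exists [::]; split=> //; rewrite big_nil.
by apply: ideal_genD => //; rewrite -mulN1r ideal_genMl.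
Qed.

HB.instance Definition _ := GRing.isZmodClosed.Build R (ideal_gen S)
  ideal_gen_zmod.

(* The R-module R/(S). *)
Definition cyclic_mod : Type := {ideal_quot ideal_gen S}.

HB.instance Definition _ := GRing.Zmodule.on cyclic_mod.

Definition cyclic_pi (f : R) : cyclic_mod := \pi_{ideal_quot ideal_gen S} f.

Definition cyclic_scale (a : R) (x : cyclic_mod) : cyclic_mod :=
  cyclic_pi (a * repr (x : {ideal_quot ideal_gen S})).

Lemma cyclic_pi_eq f g : cyclic_pi f = cyclic_pi g <-> f - g \in ideal_gen S.
Proof. by rewrite Quotient.idealrBE; split=> /eqP. Qed.

Lemma cyclic_piD f g : cyclic_pi (f + g) = cyclic_pi f + cyclic_pi g.
Proof. exact: Quotient.pi_add. Qed.

Lemma cyclic_scaleE a f : cyclic_scale a (cyclic_pi f) = cyclic_pi (a * f).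
Proof.
apply/cyclic_pi_eq; rewrite -mulrBr ideal_genMl //.
by apply/cyclic_pi_eq; rewrite /cyclic_pi reprK.
Qed.

Lemma cyclic_pi_surj x : exists f, x = cyclic_pi f.
Proof.
by exists (repr (x : {ideal_quot ideal_gen S})); rewrite /cyclic_pi reprK.
Qed.

Lemma cyclic_scaleA a b x :
  cyclic_scale a (cyclic_scale b x) = cyclic_scale (a * b) x.
Proof. by have [f ->] := cyclic_pi_surj x; rewrite !cyclic_scaleE mulrA. Qed.

Lemma cyclic_scale1 : left_id 1 cyclic_scale.
Proof. by move=> x; have [f ->] := cyclic_pi_surj x; rewrite cyclic_scaleE mul1r. Qed.

Lemma cyclic_scaleDr : right_distributive cyclic_scale +%R.
Proof.
move=> a x y; have [f ->] := cyclic_pi_surj x; have [g ->] := cyclic_pi_surj y.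
by rewrite -cyclic_piD !cyclic_scaleE mulrDr cyclic_piD.
Qed.

Lemma cyclic_scaleDl x : {morph cyclic_scale^~ x : a b / a + b}.
Proof.
move=> a b; have [f ->] := cyclic_pi_surj x.
by rewrite !cyclic_scaleE mulrDl cyclic_piD.
Qed.

HB.instance Definition _ := GRing.Zmodule_isLmodule.Build R cyclic_mod
  cyclic_scaleA cyclic_scale1 cyclic_scaleDr cyclic_scaleDl.

Lemma cyclic_piZ a f : cyclic_pi (a * f) = a *: cyclic_pi f.
Proof. exact: esym (cyclic_scaleE a f). Qed.

End IdealQuotient.

(* The degree d part of the standard grading, indexed by all integers: it is
   zero for d < 0. *)
Definition homog_part (K : fieldType) (N : nat) (d : int) (f : {mpoly K[N]}) :
    Prop :=
  forall m, m \in msupp f -> (mdeg m)%:Z = d.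

Definition cyclic_grading (K : fieldType) (N : nat) (S : {mpoly K[N]} -> Prop)
    (d : int) (x : cyclic_mod S) : Prop :=
  exists f, homog_part d f /\ x = cyclic_pi S f.

Section Resolution.

Variables (K : fieldType) (N : nat).
Local Notation R := {mpoly K[N]}.

(* M is a graded R-module; [gr d] is its homogeneous part of degree d. *)
Variables (M : lmodType R) (gr : int -> M -> Prop).

Definition combination (b : nat) (e : 'I_b -> M) (v : 'rV[R]_b) : M :=
  \sum_(a < b) v 0 a *: e a.

(* A minimal graded free resolution
     ... -> F_2 -> F_1 -> F_0 -> M -> 0,  F_i = \bigoplus_a R(- res_deg i a),
   with F_i the row vectors of length [res_rank i]; the map F_(i+1) -> F_i is
   right multiplication by [res_diff i], and F_0 -> M sends the a-th basis
   vector to [res_aug a].  The homogeneity conditions say that these maps have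
   degree 0; minimality says that the differentials have image in (X_1,..,X_N)F. *)
Record min_graded_free_res := MinGradedFreeRes {
  res_rank : nat -> nat;
  res_deg : forall i, 'I_(res_rank i) -> int;
  res_aug : 'I_(res_rank 0) -> M;
  res_diff : forall i, 'M[R]_(res_rank i.+1, res_rank i);
  res_aug_homog : forall a, gr (res_deg a) (res_aug a);
  res_diff_homog : forall i a c,
    homog_part (res_deg a - res_deg c) (res_diff i a c);
  res_aug_surj : forall x, exists v, combination res_aug v = x;
  res_exact0 : forall v : 'rV[R]_(res_rank 0),
    combination res_aug v = 0 <-> exists w, v = w *m res_diff 0;
  res_exactS : forall i (v : 'rV[R]_(res_rank i.+1)),
    v *m res_diff i = 0 <-> exists w, v = w *m res_diff i.+1;
  res_minimal : forall i a c, (res_diff i a c)@_0%MM = 0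
}.

(* beta_{i,j}(M) = b: a relation, since the Betti number is read off a minimal
   resolution, and these are unique only up to isomorphism.  In the same way
   [is_pdim p] is "p is the maximum of the i with some beta_{i,j}(M) <> 0"; it
   constrains every minimal resolution and requires one to exist. *)
Definition graded_betti (i : nat) (j : int) (b : nat) : Prop :=
  exists F : min_graded_free_res, b = #|[set a | @res_deg F i a == j]|.

Definition is_pdim (p : nat) : Prop :=
  (exists j b, graded_betti p j b /\ b <> 0%N) /\
  (forall i j b, graded_betti i j b -> b <> 0%N -> (i <= p)%N).

End Resolution.

Record sgraph := SGraph {
  vertex :> finType;
  adj : rel vertex;
  adj_sym : ssrbool.symmetric adj;
  adj_irrefl : irreflexive adj
}.

(* K[V(G)]: the variables are indexed by the vertices through [enum_rank]. *)
Notation graph_ring K G := {mpoly K[#|vertex G|]}.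

Definition graph_var (K : fieldType) (G : sgraph) (x : G) :
  graph_ring K G := 'X_(enum_rank x).

Definition edge_monomial (K : fieldType) (G : sgraph)
    (f : graph_ring K G) : Prop :=
  exists x y : G, adj x y /\ f = graph_var K x * graph_var K y.

(* R/I(G), with I(G) the ideal generated by the edge monomials. *)
Definition edge_quotient (K : fieldType) (G : sgraph) :
    lmodType (graph_ring K G) :=
  cyclic_mod (@edge_monomial K G).

Definition edge_grading (K : fieldType) (G : sgraph) :
    int -> edge_quotient K G -> Prop :=
  @cyclic_grading K _ (@edge_monomial K G).

(* The vertices of T_{n,k} are the words of length at most k whose first letter
   is < n and whose other letters are < n - 1; the root is the empty word, and
   the children of a word w are the words obtained by appending a letter.  *)
Definition psr_vertex (n k : nat) : finType :=
  {w : k.-bseq 'I_n | all (fun a : 'I_n => (a < n.-1)%N) (behead w)}.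

Definition word (n k : nat) (w : psr_vertex n k) : seq 'I_n := val (val w).

Definition psr_child (n k : nat) : rel (psr_vertex n k) :=
  fun u w => [exists a : 'I_n, word w == rcons (word u) a].

Definition psr_adj (n k : nat) : rel (psr_vertex n k) :=
  fun u w => psr_child u w || psr_child w u.

Lemma psr_adj_sym n k : ssrbool.symmetric (@psr_adj n k).
Proof. by move=> u w; rewrite /psr_adj orbC. Qed.

Lemma psr_adj_irrefl n k : irreflexive (@psr_adj n k).
Proof.
move=> u; rewrite /psr_adj orbb; apply/existsP => -[a /eqP/(congr1 size)].
by rewrite size_rcons => /n_Sn.
Qed.

Definition psr_tree (n k : nat) : sgraph :=
  SGraph (@psr_adj_sym n k) (@psr_adj_irrefl n k).

(* Main.v *)
(* For a simplicial complex D on the variables let I_D be its Stanley-Reisner ideal.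
   If x is a cone point of D and g is a squarefree monomial prime to x, multiplication
   by g induces an injection R/(I_D : g) -> R/I_D; lift it to a chain map phi between
   minimal resolutions. As x is regular modulo I_D, the mapping cone of x phi resolves
   R/(I_D + (x g)), and it is minimal because x divides every entry of x phi. Hence
   pdim R/(I_D + (x g)) = max (pdim R/I_D, pdim R/(I_D : g) + 1). The largest codimension
   of a facet obeys the same recursion. Every edge ideal of a forest is reached from 0 by
   such steps (g = 1 adds a variable, g = y an edge at the leaf x), so for a forest pdim is
   the number of vertices minus the least size of a maximal independent set. Minimal
   resolutions are unique enough for this to determine every one of them. In T_{n,k} a
   smallest maximal independent set is formed by every third level, counted from the level
   above the leaves, together with the root when 3 divides k. *)
Require Import Defs.
From mathcomp Require Import all_boot all_order all_algebra mpoly.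
From mathcomp Require Import boolp ring zify.

Set Implicit Arguments.
Unset Strict Implicit.
Unset Printing Implicit Defensive.

Import GRing.Theory.

Local Open Scope ring_scope.

(** * Comparison of minimal resolutions *)

Lemma row_choice (R : pzRingType) m n p (B : 'M[R]_(n, p)) (A : 'M[R]_(m, p)) :
  (forall a, exists w : 'rV[R]_n, row a A = w *m B) ->
  exists W : 'M[R]_(m, n), A = W *m B.
Proof.
move=> /choice[f fE]; exists (\matrix_a f a).
by apply/row_matrixP => a; rewrite row_mul rowK.
Qed.

Section MinimalUniqueness.

Variables (K : fieldType) (N : nat).
Local Notation R := {mpoly K[N]}.
Variables (M : lmodType R) (gr : int -> M -> Prop).
Implicit Types F G : min_graded_free_res gr.

Definition augm F (v : 'rV[R]_(res_rank F 0)) : M := combination (@res_aug _ _ _ _ F) v.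

(** The kernel of the augmentation in degree 0 and of the differential above it, so that exactness
    becomes one statement for all degrees. *)
Definition cycle F i : 'rV[R]_(res_rank F i) -> Prop :=
  match i with
  | 0 => fun v => augm v = 0
  | j.+1 => fun v => v *m res_diff F j = 0
  end.

Lemma cycleP F i v : @cycle F i v <-> exists w, v = w *m res_diff F i.
Proof. by case: i v => [|i] v; [exact: res_exact0 | exact: res_exactS]. Qed.

Lemma augmD F (v w : 'rV_(res_rank F 0)) : augm (v + w) = augm v + augm w.
Proof.
by rewrite /augm /combination -big_split; apply: eq_bigr => a _; rewrite mxE scalerDl.
Qed.

Lemma augmZ F c (v : 'rV_(res_rank F 0)) : augm (c *: v) = c *: augm v.
Proof.
by rewrite /augm /combination scaler_sumr; apply: eq_bigr => a _; rewrite mxE scalerA.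
Qed.

Lemma augm_mul F m (v : 'rV_m) (A : 'M_(m, res_rank F 0)) :
  augm (v *m A) = \sum_a v 0 a *: augm (row a A).
Proof.
rewrite /augm /combination [RHS](eq_bigr (fun a =>
  \sum_b (v 0 a * A a b) *: res_aug b)) => [|a _]; last first.
  by rewrite scaler_sumr; apply: eq_bigr => b _; rewrite mxE scalerA.
by rewrite exchange_big; apply: eq_bigr => b _ /=; rewrite mxE scaler_suml.
Qed.

Lemma lift_aug F G : exists A : 'M_(res_rank F 0, res_rank G 0),
  forall v, augm (v *m A) = augm v.
Proof.
have /choice[f fE] (a : 'I_(res_rank F 0)) : exists v : 'rV_(res_rank G 0), augm v = res_aug a.
  exact: (res_aug_surj G).
exists (\matrix_a f a) => v; rewrite augm_mul.
by apply: eq_bigr => a _; rewrite rowK fE.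
Qed.

Definition cycle_map F G i (A : 'M_(res_rank F i, res_rank G i)) :=
  forall v, cycle v -> cycle (v *m A).

Lemma row_diff_cycle F i a : cycle (row a (res_diff F i)).
Proof. by apply/cycleP; exists (delta_mx 0 a); rewrite rowE. Qed.

Lemma lift_step F G i (A : 'M_(res_rank F i, res_rank G i)) : cycle_map A ->
  exists2 B : 'M_(res_rank F i.+1, res_rank G i.+1),
    res_diff F i *m A = B *m res_diff G i & cycle_map B.
Proof.
move=> cA; have [a|B BE] := @row_choice _ _ _ _ (res_diff G i) (res_diff F i *m A).
  by rewrite row_mul; apply/cycleP/cA/row_diff_cycle.
exists B => // v /= v0.
by rewrite -mulmxA -BE mulmxA v0 mul0mx.
Qed.

(** The comparison theorem one degree at a time: only the degree [i] parts of the chain maps [A],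
    [B] and of the homotopy [h] are carried along. The third clause is what the next lifting step
    needs; the last one is the homotopy formula, available from degree 1 on. *)
Lemma minimal_homotopy F G i :
  exists (A : 'M_(res_rank F i, res_rank G i)) (B : 'M_(res_rank G i, res_rank F i))
         (h : 'M_(res_rank F i, res_rank F i.+1)),
  [/\ cycle_map A, cycle_map B,
    (forall v, cycle v -> v *m (1%:M - A *m B - h *m res_diff F i) = 0) &
    match i return 'M_(res_rank F i, res_rank G i) -> 'M_(res_rank G i, res_rank F i) ->
         'M_(res_rank F i, res_rank F i.+1) -> Prop with
    | 0 => fun _ _ _ => True
    | j.+1 => fun A B h => exists h', 1%:M - A *m B = h *m res_diff F j.+1 + res_diff F j *m h'
    end A B h].
Proof.
elim: i => [|i [A [B [h [cA cB hh _]]]]].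
  have [A AE] := lift_aug F G; have [B BE] := lift_aug G F.
  have [a|h hE] := @row_choice _ _ _ _ (res_diff F 0) (1%:M - A *m B).
    apply/cycleP => /=; rewrite rowE mulmxBr mulmx1 mulmxA -[X in _ - X]scale1r -scaleNr.
    by rewrite augmD augmZ BE AE scaleN1r subrr.
  exists A, B, h; split=> //; [move=> v /= | move=> v /= | move=> v _].
  - by rewrite AE.
  - by rewrite BE.
  - by rewrite hE subrr mulmx0.
have [A' AE cA'] := lift_step cA; have [B' BE cB'] := lift_step cB.
(* Rows of [res_diff F i] are cycles, so the induction hypothesis kills their images under
   [1 - A B - h d]. Hence [1 - A' B' - d h] has cycles as rows and factors through the next
   differential. *)
have [a|h' hE] := @row_choice _ _ _ _ (res_diff F i.+1)
    (1%:M - A' *m B' - res_diff F i *m h).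
  apply/cycleP => /=; rewrite -row_mul mulmxBl mulmxBl mul1mx -!mulmxA -BE.
  rewrite [A' *m _]mulmxA -AE.
  have -> : res_diff F i - res_diff F i *m A *m B - res_diff F i *m (h *m res_diff F i)
     = res_diff F i *m (1%:M - A *m B - h *m res_diff F i).
    by rewrite !mulmxBr mulmx1 !mulmxA.
  by rewrite row_mul hh //; exact: row_diff_cycle.
exists A', B', h'; split=> // [v /= v0|].
  by rewrite -hE subKr mulmxA v0 mul0mx.
by exists h; rewrite -hE subrK.
Qed.

Lemma mcoeff0_mul_diffl F i m (A : 'M_(m, _)) : map_mx (mcoeff 0%MM) (A *m res_diff F i) = 0.
Proof.
rewrite map_mxM [X in _ *m X](_ : _ = 0) ?mulmx0 //.
by apply/matrixP => a b; rewrite !mxE; exact: res_minimal.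
Qed.

Lemma mcoeff0_mul_diffr F i m (A : 'M_(_, m)) : map_mx (mcoeff 0%MM) (res_diff F i *m A) = 0.
Proof.
rewrite map_mxM [X in X *m _](_ : _ = 0) ?mul0mx //.
by apply/matrixP => a b; rewrite !mxE; exact: res_minimal.
Qed.

(* If [G i.+1] vanishes, then the identity of [F i.+1] is null-homotopic, hence
   zero modulo the variables. *)
Lemma minimal_rank_eq0 F G i : res_rank G i.+1 = 0 -> res_rank F i.+1 = 0.
Proof.
move=> G0; have [A [B [h [_ _ _ [h' E]]]]] := minimal_homotopy F G i.+1.
have AB0 : A *m B = 0.
  apply/matrixP => a b; rewrite !mxE big1 // => c _.
  by move: (ltn_ord c); rewrite [X in (_ < X)%N]G0.
move/(congr1 (map_mx (mcoeff 0%MM))): E.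
rewrite AB0 subr0 map_mxD mcoeff0_mul_diffl mcoeff0_mul_diffr addr0 map_mx1.
case: (res_rank F i.+1) => // r /matrixP/(_ ord0 ord0)/eqP.
by rewrite !mxE eqxx oner_eq0.
Qed.

(** One finite resolution decides: by [minimal_rank_eq0] every other minimal resolution vanishes
    wherever [F] does in positive degree, and the degree of any basis vector of [F_p] gives a
    nonzero Betti number. *)
Lemma is_pdim_finite_res F p : res_rank F p <> 0 ->
  (forall i, (p < i)%N -> res_rank F i = 0) -> is_pdim gr p.
Proof.
move=> Fp Fgt; split.
  case: (posnP (res_rank F p)) => [//|Fp0].
  pose a := Ordinal Fp0.
  pose d := @res_deg _ _ _ _ F p.
  exists (d a), #|[set b | d b == d a]|; split; first by exists F.
  by apply/eqP; rewrite -lt0n; apply/card_gt0P; exists a; rewrite inE.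
move=> i j b [G ->] /eqP; rewrite -lt0n => /card_gt0P[a _].
rewrite leqNgt; apply/negP => lt_pi.
case: i a lt_pi => // i a lt_pi; move: (ltn_ord a).
by rewrite [X in (_ < X)%N](minimal_rank_eq0 G (Fgt _ lt_pi)).
Qed.

End MinimalUniqueness.

(** * Mapping cones *)

(** Builds chain maps degree by degree, the type of each component depending on the degree. *)
Lemma dependent_choice_nat (T : nat -> Type) (P : forall i, T i -> Prop)
    (Q : forall i, T i -> T i.+1 -> Prop) :
  (exists x, P 0 x) ->
  (forall i x, P i x -> exists2 y, Q i x y & P i.+1 y) ->
  exists f : forall i, T i, (forall i, P i (f i)) /\ (forall i, Q i (f i) (f i.+1)).
Proof.
move=> /cid[x0 P0] step.
have next i (x : {x | P i x}) : {y : {y | P i.+1 y} | Q i (sval x) (sval y)}.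
  by case: x => x Px; have [y Qxy Py] := cid2 (step i x Px); exists (exist _ y Py).
pose g := nat_rect (fun i => {x | P i x}) (exist _ x0 P0) (fun i x => sval (next i x)).
exists (fun i => sval (g i)); split=> i; first exact: svalP (g i).
exact: svalP (next i (g i)).
Qed.

(** * Selecting monomials; homogeneous components *)

Section MonomialSelection.

Variables (K : fieldType) (N : nat).
Local Notation R := {mpoly K[N]}.

(** Serves twice: for homogeneous components, and for the part of a polynomial divisible by a
    monomial. *)
Definition msel (P : pred 'X_{1..N}) (f : R) : R :=
  \sum_(m <- msupp f | P m) f@_m *: 'X_[m].

Lemma mcoeff_msel P f m : (msel P f)@_m = if P m then f@_m else 0.
Proof.
rewrite /msel raddf_sum /=.
under eq_bigr do rewrite mcoeffZ mcoeffX.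
have [mf|mf] := boolP (m \in msupp f); last first.
  rewrite (memN_msupp_eq0 mf) if_same big_seq_cond big1 // => m' /andP[m'f _].
  by case: eqP => [E|_]; [rewrite -E m'f in mf | rewrite mulr0].
case: ifP => Pm; last first.
  rewrite big1 // => m' Pm'.
  by case: eqP => [E|_]; [rewrite -E Pm' in Pm | rewrite mulr0].
rewrite -big_filter (bigD1_seq m) ?filter_uniq ?msupp_uniq ?mem_filter ?Pm //=.
by rewrite eqxx mulr1 big1 ?addr0 // => m' /negbTE->; rewrite mulr0.
Qed.

End MonomialSelection.

Section HomogeneousComponents.

Variables (K : fieldType) (N : nat).
Local Notation R := {mpoly K[N]}.
Implicit Types (d e : int) (f g : R).

Definition homog_comp d f : R := msel (fun m => (mdeg m)%:Z == d) f.

Lemma mcoeff_homog_comp d f m :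
  (homog_comp d f)@_m = if (mdeg m)%:Z == d then f@_m else 0.
Proof. exact: mcoeff_msel. Qed.

Lemma homog_comp_homog d f : homog_part d (homog_comp d f).
Proof.
by move=> m; rewrite mcoeff_msupp mcoeff_homog_comp; case: ifP => [/eqP//|]; rewrite eqxx.
Qed.

Lemma homog_partP d f : homog_part d f <-> homog_comp d f = f.
Proof.
split=> [fd|<-]; last exact: homog_comp_homog.
apply/mpolyP => m; rewrite mcoeff_homog_comp; case: eqP => // md.
by apply/esym/memN_msupp_eq0/negP => /fd.
Qed.

(** In each coefficient of the product only monomials of degree [e] of [g] contribute, which fixes
    the degree of the other factor. *)
Lemma homog_compM d e f g : homog_part e g ->
  homog_comp (d + e) (f * g) = homog_comp d f * g.
Proof.
move=> ge; apply/mpolyP => m; rewrite mcoeff_homog_comp.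
rewrite !mcoeffM.
rewrite [RHS](eq_bigr (fun k : 'X_{1..N < (mdeg m).+1, (mdeg m).+1} =>
  if (mdeg m)%:Z == d + e then f@_(bmnm k.1) * g@_(bmnm k.2) else 0)); last first.
  move=> k /eqP/(congr1 (fun m' => (mdeg m')%:Z)) mk; rewrite mcoeff_homog_comp.
  have [kg|/memN_msupp_eq0->] := boolP (bmnm k.2 \in msupp g); last by rewrite !mulr0 if_same.
  rewrite mk mdegD PoszD (ge _ kg) (inj_eq (addIr e)).
  by case: ifP => // _; rewrite mul0r.
by case: ifP => // _; rewrite big1.
Qed.

Lemma homog_comp_sum d I (r : seq I) (P : pred I) (F : I -> R) :
  homog_comp d (\sum_(i <- r | P i) F i) = \sum_(i <- r | P i) homog_comp d (F i).
Proof.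
apply/mpolyP => m; rewrite mcoeff_homog_comp !(raddf_sum (mcoeff m)).
case: ifP => md; last by rewrite big1 // => i _; rewrite [LHS]mcoeff_homog_comp md.
by apply: eq_bigr => i _; rewrite [RHS]mcoeff_homog_comp md.
Qed.

Lemma homog_partM d e f g : homog_part d f -> homog_part e g ->
  homog_part (d + e) (f * g).
Proof. by move=> /homog_partP fd ge; apply/homog_partP; rewrite homog_compM // fd. Qed.

Lemma homog_part_sum d I (r : seq I) (P : pred I) (F : I -> R) :
  (forall i, P i -> homog_part d (F i)) -> homog_part d (\sum_(i <- r | P i) F i).
Proof.
by move=> Fd; apply/homog_partP; rewrite homog_comp_sum; apply: eq_bigr => i /Fd/homog_partP.
Qed.

Lemma homog_part0 d : homog_part d (0 : R).
Proof. by move=> m; rewrite msupp0. Qed.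

Lemma homog_partN d f : homog_part d f -> homog_part d (- f).
Proof. by move=> fd m; rewrite (perm_mem (msuppN f)); apply: fd. Qed.

Lemma homog_partX m : homog_part (mdeg m)%:Z ('X_[m] : R).
Proof. by move=> m'; rewrite msuppX inE => /eqP->. Qed.

Lemma homog_part1 : homog_part 0 (1 : R).
Proof. by have := @homog_partX 0%MM; rewrite mdeg0 mpolyX0. Qed.

End HomogeneousComponents.

(** * Minimal resolutions of R/I and lifts of multiplication maps *)

Definition is_ideal (R : pzRingType) (I : R -> Prop) :=
  [/\ I 0, forall p q, I p -> I q -> I (p + q) & forall a p, I p -> I (a * p)].

(* A complex of free modules [F_i] resolving R/I, with the augmentation
   [F_0 -> R/I] lifted to a map [aug : F_0 -> R]. *)
Record free_complex (K : fieldType) (N : nat) := FreeComplex {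
  rk : nat -> nat;
  dg : forall i, 'I_(rk i) -> int;
  aug : 'cV[{mpoly K[N]}]_(rk 0);
  dif : forall i, 'M[{mpoly K[N]}]_(rk i.+1, rk i)
}.

Section IdealResolution.

Variables (K : fieldType) (N : nat).
Local Notation R := {mpoly K[N]}.
Implicit Types (I : R -> Prop) (F A B : free_complex K N).

Definition cyc F I i : 'rV[R]_(rk F i) -> Prop :=
  match i with
  | 0 => fun v => I ((v *m aug F) 0 0)
  | j.+1 => fun v => v *m dif F j = 0
  end.

Definition homog_mx e m n (da : 'I_m -> int) (db : 'I_n -> int) (A : 'M[R]_(m, n)) :=
  forall a c, homog_part (da a + e - db c) (A a c).

(** Surjectivity onto R/I is expressed by [ires_unit], a degree 0 lift [u] of 1 to F_0; the same [u]
    starts the lifting of chain maps. *)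
Record min_ideal_res F I : Prop := MinIdealRes {
  ires_aug : forall a, homog_part (@dg _ _ F 0 a) (aug F a 0);
  ires_dif : forall i, homog_mx 0 (@dg _ _ F i.+1) (@dg _ _ F i) (dif F i);
  ires_unit : exists2 u : 'rV_(rk F 0), forall a, homog_part (- @dg _ _ F 0 a) (u 0 a)
                & I ((u *m aug F) 0 0 - 1);
  ires_exact : forall i v, @cyc F I i v <-> exists w, v = w *m dif F i;
  ires_min : forall i a c, (dif F i a c)@_0%MM = 0
}.

(** Each coordinate of [w] is replaced by its component of the required degree; the equation
    survives because [D] is homogeneous. *)
Lemma homog_lift_row m n e d (da : 'I_n -> int) (db : 'I_m -> int)
    (D : 'M[R]_(n, m)) (v : 'rV[R]_m) w :
  homog_mx 0 da db D -> (forall c, homog_part (d + e - db c) (v 0 c)) -> v = w *m D ->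
  exists2 w', v = w' *m D & forall c, homog_part (d + e - da c) (w' 0 c).
Proof.
move=> hD hv vE; exists (\row_c homog_comp (d + e - da c) (w 0 c)); last first.
  by move=> c; rewrite mxE; exact: homog_comp_homog.
apply/rowP => c; have /homog_partP<- := hv c.
rewrite vE !mxE homog_comp_sum; apply: eq_bigr => b _; rewrite mxE.
rewrite -(homog_compM _ _ (hD b c)); congr homog_comp.
by rewrite addr0 addrA subrK.
Qed.

Lemma homog_mxM e e' m n p (da : 'I_m -> int) (db : 'I_n -> int) (dc : 'I_p -> int)
    (A : 'M[R]_(m, n)) (B : 'M[R]_(n, p)) :
  homog_mx e da db A -> homog_mx e' db dc B -> homog_mx (e + e') da dc (A *m B).
Proof.
move=> hA hB a c; rewrite mxE; apply: homog_part_sum => b _.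
rewrite (_ : _ - _ = (da a + e - db b) + (db b + e' - dc c)); first exact: homog_partM.
by rewrite !addrA subrK.
Qed.

Section Lift.

Variables (A B : free_complex K N) (IA IB : R -> Prop) (g : R) (e : int).
Hypotheses (idB : is_ideal IB) (resA : min_ideal_res A IA) (resB : min_ideal_res B IB).
Hypotheses (g_homog : homog_part e g) (gA : forall p, IA p -> IB (g * p)).

(** Multiplication by [g] from R/IA to R/IB lifts to a chain map that is homogeneous of degree [e]:
    each row is lifted through an exact complex and then made homogeneous. *)
Lemma homog_lift : exists phi : forall i, 'M[R]_(rk A i, rk B i),
  [/\ forall i, homog_mx e (@dg _ _ A i) (@dg _ _ B i) (phi i),
    forall v : 'rV_(rk A 0), IB ((v *m phi 0 *m aug B) 0 0 - g * (v *m aug A) 0 0) &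
    forall i, dif A i *m phi i = phi i.+1 *m dif B i].
Proof.
have [IB0 IBD IBM] := idB.
pose P i (f : 'M[R]_(rk A i, rk B i)) :=
  [/\ homog_mx e (@dg _ _ A i) (@dg _ _ B i) f,
    forall v, cyc IA v -> cyc IB (v *m f) &
    match i return 'M[R]_(rk A i, rk B i) -> Prop with
    | 0 => fun f => forall v : 'rV_(rk A 0), IB ((v *m f *m aug B) 0 0 - g * (v *m aug A) 0 0)
    | _ => fun=> True
    end f].
pose Q i f f' := dif A i *m f = f' *m dif B i.
have [|i f [hf cf _]|f [fP fQ]] := @dependent_choice_nat _ P Q; last first.
- by exists f; split=> [i||]; [case: (fP i) | case: (fP 0) | exact: fQ].
- have [a|f' f'E] := choice (fun a : 'I_(rk A i.+1) =>
     _ : exists w : 'rV_(rk B i.+1), row a (dif A i *m f) = w *m dif B i /\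
        forall c, homog_part (dg a + e - dg c) (w 0 c)).
    have [|w wE] := (ires_exact resB (row a (dif A i *m f))).1.
      by rewrite row_mul; apply/cf/(ires_exact resA); exists (delta_mx 0 a); rewrite rowE.
    have [|w' w'E hw'] := homog_lift_row (@ires_dif _ _ resB i) (d := dg a) (e := e) _ wE.
      move=> c; rewrite mxE -[e]add0r.
      exact: (homog_mxM (@ires_dif _ _ resA i) hf).
    by exists w'.
  exists (\matrix_a f' a).
    by apply/row_matrixP => a; rewrite [RHS]row_mul rowK; case: (f'E a).
  split=> //; first by move=> a c; rewrite mxE; case: (f'E a) => _; exact.
  move=> v /= v0; rewrite -mulmxA (_ : _ *m dif B i = dif A i *m f) ?mulmxA ?v0 ?mul0mx //.
  by apply/row_matrixP => a; rewrite row_mul rowK; case: (f'E a).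
- have [u hu uE] := ires_unit resB.
  (* A basis vector of A_0 goes to [g] times its augmentation times [u], where [u] lifts 1 in
     R/IB. *)
  exists (g *: (aug A *m u)).
  have auE v : IB ((v *m (g *: (aug A *m u)) *m aug B) 0 0 - g * (v *m aug A) 0 0).
    rewrite -!scalemxAr -!scalemxAl mulmxA -(mulmxA (v *m aug A)).
    rewrite mxE [X in g * X]mxE big_ord1 -[X in _ - g * X]mulr1 -mulrBr -mulrBr mulrA.
    exact: IBM.
  split=> // [a c|v /= /gA cv].
    rewrite !mxE big_ord1 [_ + e]addrC -!addrA.
    apply: homog_partM g_homog (homog_partM (@ires_aug _ _ resA a) (hu c)).
  by rewrite -[X in IB X](subrK (g * (v *m aug A) 0 0)); exact: IBD.
Qed.

End Lift.

(** * The mapping cone of [x phi] *)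

Section Cone.

Variables (A B : free_complex K N) (x : R) (phi : forall i, 'M[R]_(rk A i, rk B i)) (s : int).

(** [A] moved up by one homological degree, with the zero module in degree 0; [s] will be the degree
    of [x g]. *)
Definition shift_rk i := if i is j.+1 then rk A j else 0%N.

Definition shift_dg i : 'I_(shift_rk i) -> int :=
  match i with 0 => fun=> 0 | j.+1 => fun a => dg a + s end.

Definition shift_dif i : 'M[R]_(rk A i, shift_rk i) :=
  match i with 0 => 0 | j.+1 => dif A j end.

Definition cone : free_complex K N := {|
  rk i := (rk B i + shift_rk i)%N;
  dg i a := match split a with inl b => dg b | inr c => shift_dg c end;
  aug := col_mx (aug B) 0;
  dif i := block_mx (dif B i) 0 (x *: phi i) (- shift_dif i)
|}.

End Cone.

Section ConeResolution.

Variables (A B : free_complex K N) (IA IB : R -> Prop) (x g : R) (e ex : int).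
Hypotheses (idB : is_ideal IB) (resA : min_ideal_res A IA) (resB : min_ideal_res B IB).
Hypotheses (g_homog : homog_part e g) (x_homog : homog_part ex x) (x0 : x@_0%MM = 0).
Hypothesis (colon_g : forall p, IA p <-> IB (g * p)).
Hypothesis (x_regular : forall p : R, IB (x * p) -> IB p).

Let IC (p : R) := exists q, IB (p - q * (x * g)).

(** Since [IA] is the colon ideal IB : g and [x] is regular modulo [IB], multiplication by [x g]
    embeds R/IA into R/IB, with cokernel R/IC; the cone of the lift [x phi] resolves this cokernel.
    It is minimal because [x] has no constant term. *)
Lemma cone_res : exists2 C, min_ideal_res C IC &
  forall i, rk C i = (rk B i + shift_rk A i)%N.
Proof.
have [IB0 IBD IBM] := idB.
have IBN (p : R) : IB p -> IB (- p) by rewrite -mulN1r; exact: IBM.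
have IBB (p q : R) : IB p -> IB q -> IB (p - q) by move=> Ip /IBN; exact: IBD.
have IBe (p q : R) : IB (p - q) -> IB p <-> IB q.
  move=> Ipq; split=> [Ip|Iq]; last by rewrite -(subrK q p); exact: IBD.
  by rewrite -(subKr p q); exact: IBB.
have [phi [hphi phi0 phiS]] := homog_lift idB resA resB g_homog (fun p => (colon_g p).1).
pose s := e + ex.
pose C := cone x phi s.
exists C => //; split.
- move=> a /=; case: (split_ordP a) => [b ->|[]//].
  by rewrite col_mxEu; exact: (@ires_aug _ _ resB).
- move=> i a c /=; rewrite -[a]splitK -[c]splitK.
  case: (split a) => a'; case: (split c) => c'; rewrite !unsplitK.
  + rewrite block_mxEul; exact: (@ires_dif _ _ resB).
  + rewrite block_mxEur mxE; exact: homog_part0.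
  + rewrite block_mxEdl mxE.
    rewrite (_ : _ - _ = ex + (dg a' + e - dg c')).
      by apply: homog_partM x_homog _; exact: hphi.
    by rewrite /s; ring.
  + rewrite block_mxEdr mxE; apply: homog_partN.
    case: i a' c' {a c} => [|i] a' c' /=; first by case: c'.
    rewrite (_ : _ - _ = dg a' + 0 - dg c'); last by ring.
    exact: (@ires_dif _ _ resA).
- have [u hu uE] := ires_unit resB.
  exists (row_mx u 0 : 'rV_(rk C 0)).
    move=> a; case: (split_ordP (a : 'I_(rk B 0 + 0))) => [b ->|[]//].
    by rewrite row_mxEl /=; case: split_ordP => [b' /lshift_inj<-|[]//].
  exists 0; rewrite mul0r subr0 /= mul_row_col mulmx0 addr0; exact: uE.
- have difE i (b : 'rV_(rk B i.+1)) (a : 'rV_(rk A i)) :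
      (row_mx b a : 'rV_(rk C i.+1)) *m dif C i =
      row_mx (b *m dif B i + x *: (a *m phi i)) (- (a *m shift_dif A i)).
    by rewrite /= mul_row_block mulmx0 add0r mulmxN -scalemxAr.
  (* With [a = a' d], the vector [b + x a' phi] is a cycle of [B], say [b' d]; then [(b', - a')] is
     a preimage of [(b, a)]. *)
  have lift_cyc i (b : 'rV_(rk B i.+1)) (a : 'rV_(rk A i)) : cyc IA a ->
      b *m dif B i + x *: (a *m phi i) = 0 ->
      exists w, (row_mx b a : 'rV_(rk C i.+1)) = w *m dif C i.+1.
    move=> /(ires_exact resA)[a' ->] ba.
    have [|b' bE] := (ires_exact resB (b + x *: (a' *m phi i.+1) : 'rV_(rk B i.+1))).1.
      by rewrite /= mulmxDl -scalemxAl -(mulmxA a') -phiS (mulmxA a').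
    exists (row_mx b' (- a')); rewrite difE -bE /= !mulNmx opprK.
    by rewrite scalerN addrK.
  have dif_cyc i (a : 'rV_(rk A i.+1)) : a *m dif A i *m shift_dif A i = 0.
    case: i a => [|i] a; first by rewrite /= mulmx0.
    by apply/(ires_exact resA (a *m dif A i.+1)); exists a.
  have dif_comp i (w : 'rV_(rk C i.+2)) : w *m dif C i.+1 *m dif C i = 0.
    rewrite -[w](@hsubmxK _ _ (rk B i.+2) (rk A i.+1)) !difE /=.
    rewrite !mulNmx dif_cyc oppr0 oppr0 mulmxDl -scalemxAl scalerN.
    rewrite -[_ *m phi i.+1 *m _]mulmxA -phiS mulmxA addrK.
    rewrite [X in row_mx X _](_ : _ = 0) ?row_mx0 //.
    set b := lsubmx _.
    by apply/(ires_exact resB (b *m dif B i.+1)); exists b.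
  have augE (b : 'rV_(rk B 0)) (a : 'rV_(rk A 0)) :
      ((b + x *: (a *m phi 0%N)) *m aug B) 0 0 =
      (b *m aug B) 0 0 + x * (a *m phi 0%N *m aug B) 0 0.
    by rewrite mulmxDl -scalemxAl !mxE.
  case=> [|i] v.
    rewrite -[v](@hsubmxK _ _ (rk B 0) 0); set b := lsubmx _; set a := rsubmx _.
    rewrite (_ : a = 0); last by apply/rowP => -[].
    rewrite /= mul_row_col mul0mx addr0; split=> [[q IBq]|[w]].
      (* If [b] has augmentation [q x g] modulo [IB], subtracting [q x] times the image under [phi]
         of a lift [u] of 1 in R/IA leaves a cycle of [B]. *)
      have [u _ uE] := ires_unit resA.
      have [|b' bE] := (ires_exact resB (b + x *: ((- q *: u) *m phi 0%N) : 'rV_(rk B 0))).1.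
        rewrite /= augE; set P := (_ *m phi 0%N *m _) 0 0.
        have IP := phi0 (- q *: u); rewrite -/P -scalemxAl mxE in IP.
        have /colon_g Iu := uE.
        rewrite (_ : _ + _ = ((b *m aug B) 0 0 - q * (x * g))
          + x * (P - g * (- q * (u *m aug A) 0 0))
          + (- q * x) * (g * ((u *m aug A) 0 0 - 1))); last by ring.
        exact: IBD (IBD _ _ IBq (IBM _ _ IP)) (IBM _ _ Iu).
      exists (row_mx b' (q *: u)); rewrite difE -bE -scalemxAl scalerA.
      by rewrite -scalemxAl scalerA mulrN scaleNr subrK /= mulmx0 oppr0.
    rewrite -[w](@hsubmxK _ _ (rk B 1) (rk A 0)) difE => /eq_row_mx[-> _].
    set b' := lsubmx _; set a' := rsubmx _; exists ((a' *m aug A) 0 0).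
    rewrite augE (_ : _ - _ = ((b' *m dif B 0) *m aug B) 0 0
      + x * ((a' *m phi 0%N *m aug B) 0 0 - g * (a' *m aug A) 0 0)); last by ring.
    by apply: IBD; [apply/(ires_exact resB (b' *m dif B 0)); exists b' | exact/IBM/phi0].
  split=> [|[w ->]]; last exact: dif_comp.
  rewrite -[v](@hsubmxK _ _ (rk B i.+1) (rk A i)); set b := lsubmx _; set a := rsubmx _.
  move=> va; have : (row_mx b a : 'rV_(rk C i.+1)) *m dif C i = 0 := va.
  rewrite difE -[RHS](@row_mx0 _ _ (rk B i) (shift_rk A i)) => /eq_row_mx[ba0 a0] {va}.
  (* In degree 1, [x a phi] is minus a boundary of [B], so [x g] times the augmentation of [a] lies
     in [IB]; cancelling [x] and using the colon ideal makes [a] a cycle. In higher degrees [a0]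
     says so directly. *)
  apply: lift_cyc => //; case: i {v} b a ba0 a0 => [|i] b a ba0 a0.
    apply/colon_g/x_regular.
    have : IB ((b *m dif B 0 *m aug B) 0 0).
      by apply/(ires_exact resB (b *m dif B 0)); exists b.
    move/(IBD _ _)/(_ (IBM x _ (phi0 a))); set P := (a *m phi 0%N *m aug B) 0 0.
    have := augE (b *m dif B 0) a; rewrite ba0 mul0mx mxE -/P => /esym/eqP.
    rewrite addr_eq0 => /eqP->; rewrite mulrBr addrA addNr add0r => /IBN.
    by rewrite opprK.
  by apply/oppr_inj; rewrite oppr0.
- move=> i a c; rewrite -[a]splitK -[c]splitK /=.
  case: (split a) => a'; case: (split c) => c' /=.
  + by rewrite block_mxEul; exact: (ires_min resB).
  + by rewrite block_mxEur mxE mcoeff0.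
  + by rewrite block_mxEdl mxE rmorphM /= x0 mul0r.
  + rewrite block_mxEdr mxE mcoeffN; case: i a' c' {a c} => [|i] a' c' /=; first by case: c'.
    by rewrite (ires_min resA) oppr0.
Qed.

End ConeResolution.

End IdealResolution.

(** * Stanley-Reisner ideals *)

Section StanleyReisner.

Variables (K : fieldType) (N : nat).
Local Notation R := {mpoly K[N]}.
Implicit Types (D : {set 'I_N} -> bool) (s t g F : {set 'I_N}) (m : 'X_{1..N}).

Definition msup m : {set 'I_N} := [set i | m i != 0%N].

Definition mset s : 'X_{1..N} := [multinom nat_of_bool (i \in s) | i < N].

Lemma msupD m m' : msup (m + m')%MM = msup m :|: msup m'.
Proof. by apply/setP => i; rewrite !inE mnmDE addn_eq0 negb_and. Qed.

Lemma msup_mset s : msup (mset s) = s.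
Proof. by apply/setP => i; rewrite inE mnmE eqb0 negbK. Qed.

Lemma mset_le s m : (mset s <= m)%MM = (s \subset msup m).
Proof.
apply/mnm_lepP/subsetP => sm i; last first.
  rewrite mnmE; case: (boolP (i \in s)) => // /sm.
  by rewrite inE lt0n.
by move=> is_; have := sm i; rewrite mnmE is_ inE lt0n.
Qed.

Lemma msetU1 x g : x \notin g -> mset (x |: g) = (mset [set x] + mset g)%MM.
Proof.
move=> xg; apply/mnmP => i; rewrite mnmDE !mnmE !inE.
by case: eqP => // ->; rewrite (negbTE xg).
Qed.

(** The Stanley-Reisner ideal of [D] by coefficients: no monomial of [p] has a face as its
    support. *)
Definition SR D (p : R) := forall m, D (msup m) -> p@_m = 0.

Definition down_closed D := forall s t, s \subset t -> D t -> D s.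

Lemma SR_ideal D : down_closed D -> is_ideal (SR D).
Proof.
move=> dcD; split=> [m _|p q Dp Dq m Dm|a p Dp m Dm]; first exact: mcoeff0.
  by rewrite mcoeffD Dp ?Dq ?addr0.
rewrite mcoeffM big1 // => k /eqP/(congr1 msup); rewrite msupD => mE.
rewrite [X in _ * X]Dp ?mulr0 //; apply: dcD Dm.
by have := subsetUr (msup (bmnm k.1)) (msup (bmnm k.2)); rewrite -mE.
Qed.

Lemma mcoeffXM p m k : ('X_[m] * p : R)@_k = if (m <= k)%MM then p@_(k - m) else 0.
Proof.
rewrite mulrC; case: ifP => mk; first by rewrite -{1}(submK mk) addmC mcoeffMX.
apply/memN_msupp_eq0; rewrite (perm_mem (msuppMX _ _)); apply/mapP => -[m' _ kE].
by rewrite kE lem_addr in mk.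
Qed.

(** Multiplying by the squarefree monomial of [s] joins [s] to the support of every monomial. *)
Lemma SR_colon D s p : SR (fun t => D (t :|: s)) p <-> SR D ('X_[mset s] * p).
Proof.
split=> Dp m Dm.
  rewrite mcoeffXM; case: ifP => // sm; apply: Dp.
  by rewrite -{2}(msup_mset s) -msupD submK.
have := Dp (mset s + m)%MM; rewrite mcoeffXM lem_addr addmC addmK; apply.
by rewrite msupD msup_mset.
Qed.

Lemma SR_add D s p : down_closed D ->
  SR (fun t => D t && ~~ (s \subset t)) p <-> exists q, SR D (p - q * 'X_[mset s]).
Proof.
move=> dcD; split=> [Dp|[q Dq] m /andP[Dm sm]]; last first.
  by have := Dq m Dm; rewrite mulrC mcoeffB mcoeffXM mset_le (negbTE sm) subr0.
(* The quotient [q] collects the monomials of [p] divisible by that of [s], each divided by it. *)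
exists (\sum_(m <- msupp p | (mset s <= m)%MM) p@_m *: 'X_[m - mset s]) => m Dm.
rewrite mulr_suml (eq_bigr (fun m => p@_m *: 'X_[m])) => [|m' sm']; last first.
  by rewrite -scalerAl -mpolyXD submK.
rewrite mcoeffB [X in _ - X]mcoeff_msel mset_le; case: ifP => sm; first by rewrite subrr.
by rewrite subr0; apply: Dp; rewrite Dm sm.
Qed.

Definition has_res D p := exists C : free_complex K N,
  [/\ min_ideal_res C (SR D), rk C p <> 0%N & forall i, (p < i)%N -> rk C i = 0%N].

(* The associated primes of I_D correspond to the facets F of D and have height N - #|F|. *)
Definition good D := exists p, [/\ has_res D p, exists2 F, maxset D F & (#|F| + p = N)%N
  & forall F, maxset D F -> (N <= p + #|F|)%N].

(** The ideal of the full simplex is 0: R resolves itself, and the whole vertex set is the only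
    facet. *)
Lemma good_simplex : good xpredT.
Proof.
pose C : free_complex K N := @FreeComplex K N (fun i => if i is 0 then 1 else 0)%N
  (fun _ _ => 0) 1%:M (fun=> 0).
exists 0%N; split.
- exists C; split=> //; last by case.
  have augE (v : 'rV_(rk C 0)) : (v *m aug C) 0 0 = v 0 0 by rewrite mulmx1.
  split.
  + move=> a; by rewrite !ord1 mxE; exact: homog_part1.
  + by move=> i a c; rewrite mxE; exact: homog_part0.
  + exists 1%:M => [a|m _].
      by rewrite !ord1 mxE oppr0; exact: homog_part1.
    by rewrite augE mxE subrr mcoeff0.
  + case=> [|i] v /=; split=> [v0|[w]].
    * exists 0; apply/rowP => a; rewrite !ord1 mulmx0 mxE; apply/mpolyP => m.
      by rewrite mcoeff0 -(v0 m isT) augE.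
    * by rewrite mulmx0 => -> m _; rewrite augE mxE mcoeff0.
    * by exists 0; apply/rowP => -[].
    * by move=> _; rewrite mulmx0.
  + by move=> i a c; rewrite mxE mcoeff0.
- exists setT; last by rewrite cardsT card_ord addn0.
  by apply/maxsetP; split=> // B _; rewrite subTset => /eqP.
- move=> F /maxsetP[_ /(_ setT isT (subsetT _))] <-.
  by rewrite cardsT card_ord.
Qed.

(** * Adding a product x g, with x a cone point *)

Section Step.

Variables (D : {set 'I_N} -> bool) (x : 'I_N) (g : {set 'I_N}).
Hypotheses (dcD : down_closed D) (xg : x \notin g).
Hypothesis (cone_x : forall s, D s -> D (x |: s)).

(** [DA] is the complex of the colon ideal I_D : g, and [DC] that of I_D + (x g). *)
Let DA s := D (s :|: g).
Let DC s := D s && ~~ (x |: g \subset s).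

Lemma maxset_colon F : maxset DA F = maxset D F && (g \subset F).
Proof.
apply/maxsetP/andP => [[DF Fmax]|[/maxsetP[DF Fmax] gF]].
  have gF : g \subset F.
    by rewrite -(Fmax (F :|: g)) ?subsetUl ?subsetUr // /DA -setUA setUid.
  split=> //; apply/maxsetP; split=> [|G DG FG]; first by apply: dcD DF; rewrite subsetUl.
  by apply: Fmax => //; rewrite /DA (setUidPl _) // (subset_trans gF).
split=> [|G DG FG]; first by rewrite /DA (setUidPl gF).
apply/eqP; rewrite eqEsubset FG andbT.
have <- : G :|: g = F by apply: Fmax => //; rewrite subsetU ?FG.
exact: subsetUl.
Qed.

Lemma maxset_cone F : maxset D F -> x \in F.
Proof.
move=> /maxsetP[DF /(_ _ (cone_x DF) (subsetUr _ _)) <-]; exact: setU11.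
Qed.

Lemma maxset_del F : maxset D F -> ~~ (g \subset F) -> maxset DC F.
Proof.
move=> /maxsetP[DF Fmax] gF; apply/maxsetP; split=> [|G /andP[DG _]]; last exact: Fmax.
by rewrite /DC DF; apply: contra gF; apply: subset_trans; rewrite subsetUr.
Qed.

Lemma maxset_delD1 F : maxset D F -> g \subset F -> maxset DC (F :\ x).
Proof.
move=> mF gF; have xF := maxset_cone mF; have /maxsetP[DF Fmax] := mF.
apply/maxsetP; split=> [|G /andP[DG xgG] FG].
  rewrite /DC (dcD _ DF) ?subD1set //; apply/subsetPn; exists x; rewrite !inE eqxx //.
have xFG : F \subset x |: G by rewrite -subDset.
have FE := Fmax _ (cone_x DG) xFG.
have [xG|xG] := boolP (x \in G); last by rewrite -FE setU1K.
by rewrite (setUidPr _) ?sub1set // in FE; rewrite FE subUset sub1set xF gF in xgG.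
Qed.

(** Extend [F] to a facet [F'] of [D]. If [F'] is not a face of [DC], it contains [x |: g]; removing
    a vertex of [x |: g] outside [F] gives a face of [DC], which is [F] by maximality. *)
Lemma maxset_delP F : maxset DC F -> maxset D F \/
  exists F', [/\ maxset D F', g \subset F' & #|F'| = #|F|.+1].
Proof.
move=> /maxsetP[/andP[DF xgF] Fmax].
have [F' mF' FF'] := maxset_exists DF; have /maxsetP[DF' _] := mF'.
have [DCF'|] := boolP (DC F'); first by left; rewrite -(Fmax _ DCF' FF').
rewrite /DC DF' negbK subUset => /andP[_ gF']; right; exists F'; split=> //.
have [z zxg zF] := subsetPn xgF.
have FE : F' :\ z = F.
  apply: Fmax; last by rewrite subsetD1 FF'.
  rewrite /DC (dcD _ DF') ?subD1set //; apply/subsetPn; exists z => //.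
  by rewrite !inE eqxx.
have zF' : z \in F'.
  move: zxg; rewrite !inE => /orP[/eqP->|/(subsetP gF')//]; exact: maxset_cone.
by rewrite (cardsD1 z) zF' FE.
Qed.

(** Length of the cone and largest facet codimension both become [maxn p q.+1]: facets of [D]
    without [g] stay facets, and those containing [g], the facets of [DA], lose one vertex. *)
Lemma good_step : good D -> good DA -> good DC.
Proof.
move=> [p [[B [resB Bp Bgt]] [F mF Fp] Dge]] [q [[A [resA Aq Agt]] [F' mF' Fq] DAge]].
have [|||C resC Crk] := @cone_res K N A B _ _ ('X_[mset [set x]]) ('X_[mset g])
   _ _ (SR_ideal dcD) resA resB (@homog_partX _ _ _) (@homog_partX _ _ _).
- rewrite mcoeffX; case: eqP => // /mnmP/(_ x).
  by rewrite !mnmE inE eqxx.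
- by move=> r; exact: SR_colon.
(* [x] is regular modulo I_D, as adding the cone point to a face gives a face. *)
- by move=> r /(SR_colon D [set x] r).2 Dr m Dm; apply: Dr; rewrite setUC cone_x.
exists (maxn p q.+1); split.
- exists C; split.
  + rewrite (_ : SR DC = fun r => exists q, SR D (r - q * ('X_[mset [set x]] * 'X_[mset g]))) //.
    apply/funext => r; apply/propext; rewrite -mpolyXD -msetU1 //; exact: SR_add.
  + rewrite Crk; case: (leqP p q.+1) => _ /=;
      by move/eqP; rewrite addn_eq0 => /andP[/eqP ? /eqP ?].
  + move=> i; rewrite gtn_max Crk => /andP[/Bgt->].
    by case: i => // i; exact: Agt.
- have := mF'; rewrite maxset_colon => /andP[DF' gF'].
  (* If [p] exceeds [q.+1], the facet [F] of codimension [p] cannot contain [g], since facets of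
     [DA] have codimension at most [q]. Otherwise [F'] without [x] attains the maximum. *)
  case: (leqP p q.+1) => [_|lt_qp]; last first.
    exists F; rewrite ?Fp //; apply: maxset_del => //; apply/negP => gF.
    have := DAge F; rewrite maxset_colon mF gF => /(_ isT).
    by clear -Fp lt_qp; lia.
  exists (F' :\ x); first exact: maxset_delD1.
  by rewrite addnS -addSn -[RHS]Fq (cardsD1 x F') (maxset_cone DF') add1n.
- move=> G /maxset_delP[mG|[G' [mG' gG' cG]]].
    by rewrite (leq_trans (Dge _ mG)) // leq_add2r leq_maxl.
  have := DAge G'; rewrite maxset_colon mG' gG' => /(_ isT) /leq_trans; apply.
  by rewrite cG addnS -addSn leq_add2r leq_maxr.
Qed.

End Step.

End StanleyReisner.

(** * Forests *)

(* Each edge [(x, y)] comes before all other edges at [x]: removing the edges in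
   order, [x] is a leaf each time. *)
Fixpoint leaf_order (T : eqType) (E : seq (T * T)) :=
  if E is (x, y) :: E' then
    [&& x != y, all (fun e => (e.1 != x) && (e.2 != x)) E' & leaf_order E']
  else true.

Lemma leaf_order_irrefl (T : eqType) (E : seq (T * T)) e : leaf_order E -> e \in E -> e.1 != e.2.
Proof.
elim: E => // -[x y] E IH /and3P[xy _ /IH{}IH]; rewrite inE => /orP[/eqP->//|].
exact: IH.
Qed.

Lemma leaf_order_map (T U : eqType) (f : T -> U) (E : seq (T * T)) : injective f ->
  leaf_order [seq (f e.1, f e.2) | e <- E] = leaf_order E.
Proof.
move=> f_inj; elim: E => //= -[x y] E /= ->; rewrite (inj_eq f_inj) all_map.
congr [&& _, _ & _]; apply: eq_all => e /=; by rewrite !(inj_eq f_inj).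
Qed.

Section Forests.

Variables (K : fieldType) (N : nat).
Implicit Types (W s t : {set 'I_N}) (E : seq ('I_N * 'I_N)) (e : 'I_N * 'I_N).

(** The faces of the complex whose ideal is generated by the variables in [W] and the edges in [E].
    [W] is there because the colon by a variable turns its neighbours into generators. *)
Definition indep_avoiding W E s :=
  (W :&: s == set0) && all (fun e => ~~ ((e.1 \in s) && (e.2 \in s))) E.

Lemma indep_avoidingP W E s :
  reflect ((forall i, i \in W -> i \notin s) /\
           (forall e, e \in E -> ~~ ((e.1 \in s) && (e.2 \in s))))
          (indep_avoiding W E s).
Proof.
apply: (iffP andP) => -[Ws Es]; split; try exact/allP.
  by move=> i iW; apply: contraL Ws => is_; apply/set0Pn; exists i; rewrite inE iW.
by apply/eqP/setP => i; rewrite !inE; apply/andP => -[/Ws/negP].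
Qed.

Lemma indep_avoiding_down W E : down_closed (indep_avoiding W E).
Proof.
move=> s t /subsetP st /indep_avoidingP[Wt Et]; apply/indep_avoidingP; split=> [i iW|e eE].
  by apply: contra (Wt i iW); apply: st.
by apply: contra (Et e eE) => /andP[/st-> /st->].
Qed.

Lemma good_eq (D D' : {set 'I_N} -> bool) : D =1 D' -> good K D -> good K D'.
Proof. by move=> /funext->. Qed.

(** The variables enter one at a time, by [good_step] with empty [g]: the colon by 1 changes
    nothing. *)
Lemma good_vars W : good K (indep_avoiding W [::]).
Proof.
have [n] := ubnP #|W|; elim: n => // n IH in W *; rewrite ltnS => Wn.
have [->|[x xW]] := set_0Vmem W.
  by apply: good_eq (good_simplex K N) => s; rewrite /indep_avoiding set0I eqxx.
pose D := indep_avoiding (W :\ x) [::].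
have gD : good K D by apply: IH; rewrite (cardsD1 x) xW in Wn.
apply: good_eq (@good_step K N D x set0 (@indep_avoiding_down _ _) _ _ gD _) => [s|||].
- rewrite setU0 sub1set; apply/andP/indep_avoidingP => [[/indep_avoidingP[Ws _] xs]|[Ws _]].
    by split=> // i iW; have [->//|ix] := eqVneq i x; apply: Ws; rewrite !inE ix.
  by split; [apply/indep_avoidingP; split=> // i /setD1P[_]; exact: Ws | exact: Ws].
- by rewrite inE.
- move=> s /indep_avoidingP[Ws _]; apply/indep_avoidingP; split=> // i iW.
  by rewrite !inE (negbTE (Ws i iW)) orbF; case/setD1P: iW.
- by apply: good_eq gD => s; rewrite setU0.
Qed.

Lemma good_forest W E : leaf_order E -> good K (indep_avoiding W E).
Proof.
elim: E W => [|[x y] E IH] W; first by move=> _; exact: good_vars.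
move=> /and3P[xy /allP xE lE]; have {}IH W' : good K (indep_avoiding W' E) := IH W' lE.
(* An edge with an end in [W] adds nothing to the ideal. Otherwise the leaf [x] meets neither [W]
   nor [E], so it is a cone point. *)
have [Wxy|] := boolP ((x \in W) || (y \in W)).
  apply: good_eq (IH W) => s; apply/idP/idP => /indep_avoidingP[Ws Es]; apply/indep_avoidingP.
    split=> // e; rewrite inE => /orP[/eqP->/=|]; last exact: Es.
    by rewrite negb_and; case/orP: Wxy => /Ws->; rewrite ?orbT.
  by split=> // e eE; apply: Es; rewrite inE eE orbT.
rewrite negb_or => /andP[xW yW].
pose D := indep_avoiding W E.
pose nb := [set z | ((z, y) \in E) || ((y, z) \in E)].
apply: good_eq (@good_step K N D x [set y] (@indep_avoiding_down _ _) _ _ (IH W) _) => [s|||].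
- rewrite subUset !sub1set /D /indep_avoiding /= -andbA; congr (_ && _); exact: andbC.
- by rewrite inE.
- move=> s /indep_avoidingP[Ws Es]; apply/indep_avoidingP; split=> [i iW|e eE].
    by rewrite !inE (negbTE (Ws i iW)) orbF; apply: contraNneq xW => <-.
  by have /andP[/negbTE e1 /negbTE e2] := xE e eE; rewrite !inE e1 e2; exact: Es.
(* The colon by [y] adds the neighbours of [y] to [W], which makes the edges at [y] redundant. *)
- apply: good_eq (IH (W :|: nb)) => s.
  apply/indep_avoidingP/indep_avoidingP => [[Ws Es]|[Ws Es]]; split=> [i|[a b] eE].
  + move=> iW; rewrite !inE negb_or Ws ?inE ?iW //.
    by apply: contraNneq yW => <-.
  + have /= ab := leaf_order_irrefl lE eE; have /= := Es _ eE; rewrite !inE.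
    have [ay|_] := eqVneq a y; have [b_y|_] := eqVneq b y; rewrite ?orbT ?orbF //=.
    * by rewrite ay b_y eqxx in ab.
    * by move=> _; apply: Ws; rewrite !inE -ay eE !orbT.
    * by move=> _; rewrite andbT; apply: Ws; rewrite !inE -b_y eE !orbT.
  + rewrite !inE => /orP[/Ws|/orP[|] iy]; first by rewrite !inE negb_or => /andP[].
      by have /= := Es _ iy; rewrite !inE eqxx orbT andbT negb_or => /andP[].
    by have /= := Es _ iy; rewrite !inE eqxx orbT /= negb_or => /andP[].
  + by apply: contra (Es _ eE) => /andP[/= sa sb]; rewrite !inE sa sb.
Qed.

End Forests.

(** * From resolutions of an ideal to the cyclic module *)

Section CyclicModule.

Variables (K : fieldType) (N : nat) (S : {mpoly K[N]} -> Prop).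
Local Notation R := {mpoly K[N]}.

Lemma cyclic_pi_sum I (r : seq I) (P : pred I) (F : I -> R) :
  cyclic_pi S (\sum_(i <- r | P i) F i) = \sum_(i <- r | P i) cyclic_pi S (F i).
Proof.
apply: (big_morph (cyclic_pi S) (@cyclic_piD _ S)); apply: (addrI (cyclic_pi S 0)).
by rewrite -cyclic_piD !addr0.
Qed.

Lemma cyclic_pi_eq0 f : cyclic_pi S f = 0 <-> f \in ideal_gen S.
Proof.
have <- : cyclic_pi S 0 = 0.
  by have := cyclic_pi_sum [::] xpredT (fun i : nat => 0); rewrite !big_nil.
by rewrite cyclic_pi_eq subr0.
Qed.

Lemma min_graded_free_res_of_ideal (C : free_complex K N) (I : R -> Prop) :
  min_ideal_res C I -> (forall f, I f <-> f \in ideal_gen S) ->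
  exists F : min_graded_free_res (@cyclic_grading K N S), res_rank F = rk C.
Proof.
move=> resC IS.
pose au a := cyclic_pi S (aug C a 0).
have combE v : combination au v = cyclic_pi S ((v *m aug C) 0 0).
  by rewrite mxE cyclic_pi_sum; apply: eq_bigr => a _; rewrite cyclic_piZ.
have hom_au a : cyclic_grading (dg a) (au a).
  by exists (aug C a 0); split=> //; exact: (ires_aug resC).
have hom_dif i a c : homog_part (dg a - dg c) (dif C i a c).
  by rewrite -[dg a]addr0; exact: (ires_dif resC).
have surj x : exists v, combination au v = x.
  have [f ->] := cyclic_pi_surj x; have [u _ uE] := ires_unit resC.
  exists (f *: u); rewrite combE; apply/cyclic_pi_eq.
  by rewrite -scalemxAl mxE -[X in _ - X]mulr1 -mulrBr; apply/ideal_genMl/IS.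
have ex0 (v : 'rV_(rk C 0)) : combination au v = 0 <-> exists w, v = w *m dif C 0.
  rewrite combE cyclic_pi_eq0 -IS; exact: (ires_exact resC v).
by exists (MinGradedFreeRes hom_au hom_dif surj ex0
  (fun i v => ires_exact resC (v : 'rV_(rk C i.+1))) (@ires_min _ _ _ _ resC)).
Qed.

End CyclicModule.

(** * Edge ideals and the projective dimension of forests *)

Section EdgeIdeal.

Variables (K : fieldType) (G : sgraph).
Local Notation N := #|vertex G|.

Definition indep (s : {set G}) := [forall x in s, forall y in s, ~~ adj x y].

Lemma indepP (s : {set G}) :
  reflect {in s &, forall x y, ~~ adj x y} (indep s).
Proof.
apply: (iffP forall_inP) => [H x y xs ys|H x xs]; first by have /forall_inP := H x xs; apply.
by apply/forall_inP => y ys; apply: H.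
Qed.

(** If [B] missed the closed neighbourhood of [v], adding [v] would keep it independent. *)
Lemma maxset_indep_dominates (B : {set G}) v :
  maxset indep B -> exists2 w, w \in B & (w == v) || adj w v.
Proof.
move=> /maxsetP[/indepP Bi Bmax].
have [vB|vB] := boolP (v \in B); first by exists v; rewrite ?eqxx.
have [/existsP[w /andP[wB wv]]|noN] := boolP [exists w, (w \in B) && adj w v].
  by exists w; rewrite ?wv ?orbT.
have nN w : w \in B -> ~~ adj w v.
  by move=> wB; apply: contra noN => wv; apply/existsP; exists w; rewrite wB.
have vBi : indep (v |: B).
  apply/indepP => x y /setU1P[->|xB] /setU1P[->|yB]; rewrite ?adj_irrefl ?nN //.
    by rewrite adj_sym nN.
  exact: Bi.
by rewrite -(Bmax _ vBi (subsetUr _ _)) setU11 in vB.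
Qed.

Definition rank_indep (s : {set 'I_N}) := indep (enum_rank @^-1: s).

(** A monomial whose support is not independent is divisible by an edge monomial, and the support of
    a multiple of an edge monomial is never independent. *)
Lemma edge_ideal_SR (p : graph_ring K G) :
  SR rank_indep p <-> p \in ideal_gen (@edge_monomial K G).
Proof.
have dcD : down_closed rank_indep.
  move=> s t /subsetP st /indepP it; apply/indepP => x y; rewrite !inE => /st xt /st yt.
  by apply: it; rewrite inE.
have [SR0 SRD SRM] := SR_ideal K dcD.
split=> [Dp|/ideal_genP[s [Ss ->]]].
  rewrite [p]mpolyE big_seq; apply: rpred_sum => m mp.
  have : ~~ rank_indep (msup m) by apply/negP => /Dp/eqP; rewrite mcoeff_eq0 mp.
  rewrite negb_forall => /existsP[x]; rewrite negb_imply inE => /andP[xm].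
  rewrite negb_forall => /existsP[y]; rewrite negb_imply inE negbK => /andP[ym xy].
  have xym : (U_(enum_rank x) + U_(enum_rank y) <= m)%MM.
    rewrite !inE in xm ym; apply/mnm_lepP => i; rewrite mnmDE !mnm1E.
    have [xi|_] := eqVneq (enum_rank x) i; have [yi|_] := eqVneq (enum_rank y) i => //=.
    - by rewrite (enum_rank_inj (etrans xi (esym yi))) adj_irrefl in xy.
    - by rewrite addn0 lt0n -xi.
    - by rewrite add0n lt0n -yi.
  rewrite -(submK xym) mpolyXD mpolyXD scalerAl; apply: ideal_genMl.
  by apply/ideal_genP; exists [:: (1, graph_var K x * graph_var K y)]; split;
    [move=> _ /[!inE] /eqP-> /=; exists x, y | rewrite big_seq1 mul1r].
rewrite big_seq; elim/big_rec: _ => [|cg q cgs Dq]; first exact: SR0.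
apply: SRD => //; apply: SRM; have [x [y [xy ->]]] := Ss _ cgs.
rewrite /graph_var -mpolyXD => m Dm; rewrite mcoeffX; case: eqP => // mE.
have /indepP/(_ x y) := Dm; rewrite !inE -mE !mnmDE !mnm1E !eqxx xy addnC.
by rewrite !addnS => /(_ isT isT).
Qed.

(** Facets of the independence complex are the maximal independent sets, so the last two clauses
    make [p] the number of vertices minus the least size of such a set. *)
Theorem is_pdim_forest (E : seq (G * G)) : leaf_order E ->
  (forall x y, adj x y = ((x, y) \in E) || ((y, x) \in E)) ->
  exists p, [/\ is_pdim (M := edge_quotient K G) (@edge_grading K G) p,
    exists2 F, maxset indep F & (#|F| + p)%N = #|G| &
    forall F, maxset indep F -> (#|G| <= p + #|F|)%N].
Proof.
move=> lE adjE; pose rk (x : G) := enum_rank x.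
have rank_inj : injective rk by exact: enum_rank_inj.
have gE : good K rank_indep.
  have := @good_forest K N set0 [seq (rk e.1, rk e.2) | e <- E].
  rewrite (leaf_order_map _ rank_inj) => /(_ lE); apply: good_eq => s.
  apply/indep_avoidingP/indepP => [[_ Es] x y|Es]; rewrite ?inE.
    move=> xs ys; rewrite adjE; apply/norP; split; apply/negP => eE.
      by have /negP[] := Es (rk x, rk y) (map_f (fun e => (rk e.1, rk e.2)) eE); rewrite xs.
    by have /negP[] := Es (rk y, rk x) (map_f (fun e => (rk e.1, rk e.2)) eE); rewrite /= ys.
  split=> [i|_ /mapP[[x y] eE ->] /=]; first by rewrite inE.
  by apply/andP => -[xs ys]; have := Es x y; rewrite !inE xs ys adjE eE => /(_ isT isT).
have maxE F : maxset rank_indep F = maxset indep (rk @^-1: F).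
  have rkK (s : {set G}) : rk @^-1: (rk @: s) = s.
    by apply/setP => x; rewrite inE mem_imset.
  have Krk (s : {set 'I_N}) : rk @: (rk @^-1: s) = s.
    apply/setP => i; apply/imsetP/idP => [[x] /[!inE] xs ->//|is_].
    by exists (enum_val i); rewrite ?inE /rk enum_valK.
  apply/maxsetP/maxsetP => -[DF Fmax]; split=> // H DH FH.
    rewrite -(Fmax (rk @: H)) ?rkK // /rank_indep ?rkK //.
    by rewrite -(Krk F); apply: imsetS.
  by rewrite -[H]Krk -[RHS]Krk (Fmax (rk @^-1: H)) //; apply: preimsetS.
have cardE (F : {set 'I_N}) : #|rk @^-1: F| = #|F|.
  rewrite on_card_preimset //; exists enum_val => i _; [exact: enum_rankK | exact: enum_valK].
have [p [[C [resC Cp Cgt]] [F mF Fp] Fge]] := gE; exists p; split.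
- have [H HE] := min_graded_free_res_of_ideal resC edge_ideal_SR.
  by apply: (@is_pdim_finite_res _ _ _ _ H); rewrite HE.
- by exists (rk @^-1: F); rewrite -?maxE // cardE.
- move=> H mH; have : maxset rank_indep (rk @: H).
    rewrite maxE (_ : rk @^-1: _ = H) //; by apply/setP => x; rewrite inE mem_imset.
  by move/Fge; rewrite card_imset.
Qed.

End EdgeIdeal.

(** * The tree T_{n,k} *)

Section SemiregularTree.

Local Open Scope nat_scope.

Variables n k : nat.
Hypothesis n_ge3 : (3 <= n)%N.
Local Notation T := (psr_vertex n k).
Implicit Types (u v w : T) (s : seq 'I_n).

Definition letters s := all (fun a : 'I_n => (a < n.-1)%N) (behead s).

Definition lev v := size (word v).

Lemma word_inj : injective (@word n k).
Proof. by move=> u v uv; do 2 apply: val_inj. Qed.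

Lemma lev_le v : (lev v <= k)%N.
Proof. exact: size_bseq. Qed.

Lemma word_letters v : letters (word v).
Proof. exact: (valP v). Qed.

Lemma word_exists s : (size s <= k)%N -> letters s -> exists v, word v = s.
Proof. by move=> sk ls; exists (exist _ (Bseq sk) ls). Qed.

Lemma letters_take l s : letters s -> letters (take l s).
Proof. by case: l s => [|l] [|a s] //= /allP ls; apply/allP => b /mem_take/ls. Qed.

Lemma anc_exists l v : exists u, word u = take l (word v).
Proof.
apply: word_exists; last exact/letters_take/word_letters.
by rewrite size_take_min (leq_trans (geq_minr _ _)) ?lev_le.
Qed.

(** The ancestor of [v] at level [l], or [v] itself when [l] is at least its level. *)
Definition anc l v := projT1 (cid (anc_exists l v)).

Lemma word_anc l v : word (anc l v) = take l (word v).
Proof. exact: (projT2 (cid (anc_exists l v))). Qed.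

Lemma psr_childE u w : psr_child u w = (0 < lev w)%N && (u == anc (lev w).-1 w).
Proof.
rewrite -(inj_eq word_inj) word_anc /lev; apply/existsP/andP => [[a /eqP->]|[]].
  by rewrite size_rcons /= -cats1 take_size_cat.
case: (lastP (word w)) => // s a _; rewrite size_rcons /= -cats1 take_size_cat // cats1.
by move=> /eqP->; exists a.
Qed.

Lemma psr_child_lev u w : psr_child u w -> lev w = (lev u).+1.
Proof. by rewrite /lev => /existsP[a /eqP->]; rewrite size_rcons. Qed.

Lemma psr_child_anc l u w : psr_child u w -> (l <= lev u)%N -> anc l w = anc l u.
Proof.
move=> /existsP[a /eqP wE] lu; apply: word_inj.
by rewrite !word_anc wE -cats1 takel_cat.
Qed.

Lemma anc_lev v : anc (lev v) v = v.
Proof. by apply: word_inj; rewrite word_anc take_size. Qed.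

Lemma child_exists v : (lev v < k)%N -> exists w, psr_child v w.
Proof.
move=> vk; have n0 : (0 < n)%N by lia.
have [||w wE] := @word_exists (rcons (word v) (Ordinal n0)).
- by rewrite size_rcons.
- rewrite /letters; have := word_letters v; rewrite /letters.
  case: (word v) => //= b s; rewrite all_rcons => -> /=; lia.
- by exists w; apply/existsP; exists (Ordinal n0); rewrite wE.
Qed.

(** Edges are listed by their lower ends, deepest first. When [v] is removed no deeper vertex
    remains, so [v] is the parent of none that is left. *)
Lemma leaf_order_sorted (L : seq T) (par : T -> T) :
  uniq L -> sorted (fun u v => lev v <= lev u)%N L ->
  (forall v, v \in L -> (lev (par v) < lev v)%N) ->
  leaf_order [seq (v, par v) | v <- L].
Proof.
elim: L => //= v L IH /andP[vL uL] sL parL; apply/and3P; split.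
- by apply: contraTneq (parL v (mem_head _ _)) => <-; rewrite ltnn.
- apply/allP => _ /mapP[w wL ->] /=; apply/andP; split.
    by apply: contraNneq vL => <-.
  have wv : (lev w <= lev v)%N.
    by have /allP/(_ w wL) := order_path_min (fun x y z => fun a b => leq_trans b a) sL.
  have := parL w; rewrite inE wL orbT => /(_ isT) pw.
  by apply: contraTneq wv => <-; rewrite -ltnNge.
- apply: IH => // [|w wL]; first exact: path_sorted sL.
  by apply: parL; rewrite inE wL orbT.
Qed.

Definition psr_edges : seq (T * T) :=
  [seq (v, anc (lev v).-1 v) |
    v <- sort (fun u v => lev v <= lev u)%N [seq v <- enum T | (0 < lev v)%N]].

Lemma psr_edges_leaf_order : leaf_order psr_edges.
Proof.
apply: leaf_order_sorted.
- by rewrite sort_uniq filter_uniq ?enum_uniq.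
- by apply: sort_sorted => u v; exact: leq_total.
- move=> v; rewrite mem_sort mem_filter => /andP[v0 _].
  by rewrite {1}/lev word_anc size_take_min gtn_min ltn_predL v0.
Qed.

Lemma psr_edgesE u w : ((w, u) \in psr_edges) = psr_child u w.
Proof.
rewrite psr_childE; apply/mapP/andP => [[v]|[w0 /eqP->]].
  by rewrite mem_sort mem_filter => /andP[v0 _] [-> ->].
by exists w => //; rewrite mem_sort mem_filter w0 mem_enum.
Qed.

(* Every third level, counted from the level above the leaves; the root is added
   when no selected level dominates it. *)
Definition dom_level l := (l.+1 == k %[mod 3]) || (l == 0%N) && (3 %| k)%N.

Definition dom_set : {set psr_tree n k} := [set v : T | dom_level (lev v)].

(** Modulo 3, an unselected level is congruent to [k] or to [k + 1]. In the first case the parent is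
    selected; in the second [v] is not a leaf and its children are selected. *)
Lemma dom_set_dominates v : v \notin dom_set -> exists2 u, u \in dom_set & psr_adj u v.
Proof.
rewrite inE /dom_level => vD; have := lev_le v => vk.
have [v_k|v_k] := eqVneq (lev v %% 3) (k %% 3).
  have vu : psr_child (anc (lev v).-1 v) v by rewrite psr_childE eqxx andbT; lia.
  exists (anc (lev v).-1 v); last by rewrite /psr_adj vu.
  by rewrite inE /dom_level; have := psr_child_lev vu; lia.
have [|w vw] := @child_exists v; first by lia.
exists w; last by rewrite /psr_adj vw orbT.
by rewrite inE /dom_level (psr_child_lev vw); lia.
Qed.

Lemma maxset_dom_set : maxset (@indep (psr_tree n k)) dom_set.
Proof.
have child_dom u v : psr_child u v -> u \in dom_set -> v \in dom_set -> False.
  by move=> /psr_child_lev; rewrite !inE /dom_level => ->; lia.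
apply/maxsetP; split=> [|B /indepP Bi DB].
  apply/indepP => u v uD vD; apply/negP => /orP[] c.
    exact: child_dom c uD vD.
  exact: child_dom c vD uD.
apply/eqP; rewrite eqEsubset DB andbT; apply/subsetP => v vB.
apply/contraT => /dom_set_dominates[u uD uv].
by have := Bi _ _ (subsetP DB _ uD) vB; rewrite /= uv.
Qed.

(* Each selected vertex is recovered from any vertex in the closed neighbourhood of
   one of its children (of itself, for the extra root): these neighbourhoods are
   disjoint, and a maximal independent set meets all of them. *)
Lemma card_dom_set_le (B : {set psr_tree n k}) :
  maxset (@indep (psr_tree n k)) B -> (#|dom_set| <= #|B|)%N.
Proof.
(* Modulo 3, [2 * k] is [- k], so [h] moves [w] up to the nearest level congruent to [k - 1];
   truncated subtraction stops at the root. *)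
move=> mB; pose h (w : T) := anc (lev w - (lev w + 1 + 2 * k) %% 3) w.
apply: leq_trans (leq_imset_card (h : psr_tree n k -> psr_tree n k) (mem B)).
apply/subset_leq_card/subsetP => d; rewrite inE /dom_level => dD; have dk := lev_le d.
have [d_k|d_k] := eqVneq ((lev d).+1 %% 3) (k %% 3).
  have [|c dc] := @child_exists d; first by lia.
  have cl := psr_child_lev dc.
  have [w wB wc] := @maxset_indep_dominates (psr_tree n k) B c mB.
  apply/imsetP; exists w => //; rewrite /h.
  move: wc => /orP[/eqP->|/orP[]].
  - rewrite (_ : _ - _ = lev d)%N; last by rewrite cl; lia.
    by rewrite (psr_child_anc dc) // anc_lev.
  - rewrite psr_childE => /andP[_ /eqP->].
    move: dc; rewrite psr_childE => /andP[_ /eqP <-].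
    by rewrite (_ : _ - _ = lev d)%N ?anc_lev; last lia.
  - move=> cw; have wl := psr_child_lev cw.
    rewrite (_ : _ - _ = lev d)%N; last by rewrite wl cl; lia.
    by rewrite (psr_child_anc cw) ?(psr_child_anc dc) ?anc_lev // cl.
(* What remains is the extra root: [w] is the root or one of its children, and [h] sends both to the
   root. *)
have d0 : lev d = 0%N by lia.
have [w wB wd] := @maxset_indep_dominates (psr_tree n k) B d mB.
apply/imsetP; exists w => //; rewrite /h -[LHS]anc_lev d0.
have k0 : (k %% 3 = 0)%N by lia.
move: wd => /orP[/eqP->|/orP[/psr_child_lev|dw]].
- by rewrite d0 sub0n.
- by rewrite d0.
- have wl := psr_child_lev dw.
  rewrite (_ : _ - _ = 0)%N; last by rewrite wl d0; lia.
  by rewrite (psr_child_anc dw).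
Qed.

Definition level_size l := if l is m.+1 then (n * n.-1 ^ m)%N else 1%N.

(** Below the root, a word consists of a first letter among [n] and of [m] letters among [n.-1]. *)
Lemma card_level l : (l <= k)%N -> #|[set v | lev v == l]| = level_size l.
Proof.
case: l => [_|m mk].
  have [|//|v vE] := @word_exists [::]; first by [].
  apply/eqP/cards1P; exists v; apply/setP => u; rewrite !inE /lev size_eq0.
  by rewrite -(inj_eq word_inj) vE.
pose wd (a : 'I_n * m.-tuple 'I_n.-1) := a.1 :: map (widen_ord (leq_pred n)) a.2.
have vx a : exists v, word v = wd a.
  apply: word_exists; first by rewrite /= size_map size_tuple.
  by apply/allP => _ /mapP[b _ ->] /=.
have [f fE] := choice vx.
have wd_inj : injective wd.
  move=> [a s] [b t] [/= -> st]; congr (_, _); apply: val_inj.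
  by apply: inj_map st => x y /(congr1 val) /= /val_inj.
have f_inj : injective f by move=> a b fab; apply: wd_inj; rewrite -!fE fab.
rewrite (_ : [set v | _] = f @: setT).
  by rewrite card_imset // cardsT card_prod card_tuple !card_ord.
apply/setP => v; rewrite inE; apply/eqP/imsetP => [|[a _ ->]]; last first.
  by rewrite /lev fE /= size_map size_tuple.
have := word_letters v; rewrite /lev /letters; case E : (word v) => [//|a s] /= /allP sl [sm].
have n1 : (0 < n.-1)%N by lia.
(* All letters of [s] are below [n.-1], so [insubd] returns the letter and never its default. *)
pose t := [seq insubd (Ordinal n1) (val b) | b <- s].
have tm : size t == m by rewrite size_map sm.
exists (a, Tuple tm) => //; apply: word_inj; rewrite fE E /wd /=; congr (_ :: _).
rewrite -map_comp -[LHS]map_id; apply/eq_in_map => b bs /=.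
by apply: val_inj; rewrite /= val_insubd [X in if X then _ else _]sl.
Qed.

Lemma card_levels (P : pred nat) :
  #|[set v | P (lev v)]| = (\sum_(l < k.+1 | P l) level_size l)%N.
Proof.
rewrite -sum1_card (partition_big (fun v => inord (lev v) : 'I_k.+1) (fun l => P l)); last first.
  by move=> v; rewrite inE inordK ?ltnS ?lev_le.
apply: eq_bigr => l Pl; rewrite -(card_level (ltn_ord l : l <= k)) -sum1_card.
apply: eq_bigl => v; rewrite !inE -val_eqE /= inordK ?ltnS ?lev_le //.
by rewrite andbC; case: eqP => //= ->.
Qed.

End SemiregularTree.

(** * Closed forms for the sizes *)

Section Counting.

Variables (n : nat).
Hypothesis n_ge3 : (3 <= n)%N.
Let N : rat := n%:R.

Lemma level_sizeE l : (level_size n l)%:R = if l is m.+1 then N * (N - 1) ^+ m else 1 :> rat.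
Proof.
case: l => // m; rewrite /level_size natrM natrX; congr (_ * _ ^+ _).
by rewrite /N -subn1 natrB //; lia.
Qed.

Lemma sum_levels k :
  (N - 2) * (\sum_(l < k.+1) level_size n l)%N%:R = N * (N - 1) ^+ k - 2.
Proof.
elim: k => [|k IH]; first by rewrite big_ord1 /=; ring.
by rewrite big_ord_recr natrD mulrDr IH level_sizeE /= exprS; ring.
Qed.

Definition dom_size k := (\sum_(l < k.+1 | dom_level k l) level_size n l)%N.

(** Old levels keep their status when [k] grows by 3, and of the three new ones only [k.+2] is
    selected. *)
Lemma dom_size_add3 k : dom_size k.+3 = (dom_size k + n * n.-1 ^ k.+1)%N.
Proof.
rewrite /dom_size !(big_mkcond (fun l : 'I_ _ => dom_level _ l)) /=.
rewrite (big_ord_recr k.+3) (big_ord_recr k.+2) (big_ord_recr k.+1) /=.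
rewrite [dom_level _ k.+3]ifF; last by rewrite /dom_level; lia.
rewrite [dom_level _ k.+2]ifT; last by rewrite /dom_level; lia.
rewrite [dom_level _ k.+1]ifF; last by rewrite /dom_level; lia.
by rewrite !addn0; congr (_ + _)%N; apply: eq_bigr => l _; congr (if _ then _ else _).
Qed.

(** Multiplying the increment N (N - 1)^(k+1) of [dom_size_add3] by (N - 1)^3 - 1 gives the
    difference of the leading terms at [k.+3] and [k]; the constants come from [k] = 0, 1, 2. *)
Lemma dom_sizeE k : ((N - 1) ^+ 3 - 1) * (dom_size k)%:R =
  if (k %% 3 == 0)%N then N * (N - 1) ^+ k.+1 + N ^+ 3 - 4 * N ^+ 2 + 4 * N - 2
  else if (k %% 3 == 1)%N then N * (N - 1) ^+ k.+1 - N ^+ 2 + 2 * N - 2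
  else N * (N - 1) ^+ k.+1 - N.
Proof.
have [m] := ubnP k; elim: m => // m IH in k *; case: k => [|[|[|k]]] km.
- rewrite /dom_size big_mkcond big_ord1 /=; ring.
- rewrite /dom_size big_mkcond !big_ord_recr big_ord0 /=; ring.
- rewrite /dom_size big_mkcond !big_ord_recr big_ord0 /= add0n addn0 add0n expn0 muln1 -/N; ring.
rewrite dom_size_add3 natrD mulrDr IH; last by lia.
rewrite (_ : k.+3 %% 3 = k %% 3)%N; last by lia.
have -> : (n * n.-1 ^ k.+1)%N%:R = N * (N - 1) ^+ k.+1 by rewrite -(level_sizeE k.+2).
rewrite !(exprS _ k.+3) !(exprS _ k.+2) !(exprS _ k.+1).
by case: ifP => _; [|case: ifP => _]; ring.
Qed.

End Counting.

Theorem corollary2p7 (n k : nat) (K : fieldType)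
    (hn : (3 <= n)%N) (hk : (1 <= k)%N) :
  let T := psr_tree n k in
  let N : rat := n%:R in
  exists p : nat,
    is_pdim (M := edge_quotient K T) (@edge_grading K T) p /\
    (p%:R : rat) =
      if (k %% 3 == 0)%N then
        (N * (N - 1) ^+ k - 2) / (N - 2)
        - (N * (N - 1) ^+ k.+1 + N ^+ 3 - 4 * N ^+ 2 + 4 * N - 2)
            / ((N - 1) ^+ 3 - 1)
      else if (k %% 3 == 1)%N then
        (N * (N - 1) ^+ k - 2) / (N - 2)
        - (N * (N - 1) ^+ k.+1 - N ^+ 2 + 2 * N - 2) / ((N - 1) ^+ 3 - 1)
      else
        (N * (N - 1) ^+ k - 2) / (N - 2)
        - (N * (N - 1) ^+ k.+1 - N) / ((N - 1) ^+ 3 - 1).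
Proof.
move=> T N.
have [x y|p [pd [F mF Fp] Fge]] := is_pdim_forest K (psr_edges_leaf_order n k) (G := T).
  by rewrite !psr_edgesE orbC.
exists p; split=> //.
(* [dom_set] is a maximal independent set no larger than [F], which has the least size, so it
   attains this size too. *)
have pE : (p + #|dom_set n k|)%N = #|T|.
  apply/eqP; rewrite eqn_leq (Fge _ (maxset_dom_set k hn)) andbT.
  by rewrite -[X in (_ <= X)%N]Fp addnC leq_add2r; exact: card_dom_set_le hn _ mF.
have TE : #|T| = (\sum_(l < k.+1) level_size n l)%N.
  by rewrite -(card_levels k hn xpredT) -cardsT; congr #|pred_of_set _|.
have DE : #|dom_set n k| = dom_size n k := card_levels k hn (dom_level k).
have N2 : N - 2 != 0 by rewrite subr_eq0 Num.Theory.eqr_nat; lia.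
have N3 : (N - 1) ^+ 3 - 1 != 0.
  have -> : N - 1 = n.-1%:R by rewrite /N -subn1 natrB //; lia.
  rewrite subr_eq0 -natrX -[1]/(1%:R) Num.Theory.eqr_nat neq_ltn orbC.
  by rewrite -{1}(exp1n 3) ltn_exp2r //; lia.
rewrite -[LHS](addrK (dom_size n k)%:R) -natrD -DE pE TE DE.
have -> : (\sum_(l < k.+1) level_size n l)%N%:R = (N * (N - 1) ^+ k - 2) / (N - 2).
  by rewrite -(sum_levels hn k) mulrC mulKf.
rewrite -[(dom_size n k)%:R](mulKf N3) (dom_sizeE hn k).
by case: ifP => _; [|case: ifP => _]; rewrite [_^-1 * _]mulrC.
Qed.
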